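(* Let $\mathbf{A}$ be an epireflective subcategory of $\mathbf{Top}$ such that every space in $\mathbf{A}$ is Hausdorff, and let $\mathbf{B}$ be an HAD-class in $\mathbf{A}$. Then $\mathbf{B}$ is closed under the formation of prime factors.
   Context: $\mathbf{Top}$ is the category of topological spaces and continuous maps. All subcategories are full and isomorphism-closed (so they are identified with classes of spaces), and every subcategory of $\mathbf{Top}$ is assumed to contain at least one space with at least two points. A subcategory of $\mathbf{Top}$ is epireflective in $\mathbf{Top}$ if and only if it is closed under topological products and subspaces. A class $\mathbf{B}\subseteq\mathbf{A}$ is an AD-class in $\mathbf{A}$ if it is additive (closed under topological sums, i.e. disjoint unions) and divisible in $\mathbf{A}$ (if $q\colon X\to Y$ is a quotient map with $X\in\mathbf{B}$ and $Y\in\mathbf{A}$, then $Y\in\mathbf{B}$). It is an HAD-class in $\mathbf{A}$ if moreover it is hereditary, i.e. closed under subspaces. For a space $X$ and $a\in X$, the prime factor $X_a$ of $X$ at $a$ is the space on the same set in which all points different from $a$ are isolated and the neighborhoods of $a$ are the same as in $X$. A class $\mathbf{B}$ is closed under the formation of prime factors if $X_a\in\mathbf{B}$ for all $X\in\mathbf{B}$ and $a\in X$. *)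

(* Defs.v *)
From HB Require Import structures.
From mathcomp Require Import all_boot all_order all_algebra.
From mathcomp Require Import all_classical all_reals all_analysis.

Set Implicit Arguments.
Unset Strict Implicit.
Unset Printing Implicit Defensive.

Local Open Scope classical_set_scope.

(* The carrier of a [topologicalType] comes with a choice operator, which is
   not topological data. The classes of spaces considered below are closed
   under homeomorphism, so they cannot depend on it. *)
Definition space_class := topologicalType -> Prop.

Definition homeomorphic (X Y : topologicalType) : Prop :=
  exists (f : X -> Y) (g : Y -> X),
    [/\ continuous f, continuous g, cancel f g & cancel g f].

(* Full isomorphism-closed subcategories of Top, identified with their classes
   of objects; a space with at least two points is always required. *)
Record subcategory (A : space_class) : Prop := Subcategory {
  subcategory_iso : forall X Y : topologicalType,
    homeomorphic X Y -> A X -> A Y;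
  subcategory_two_points : exists2 X : topologicalType,
    A X & exists x y : X, x <> y
}.

Definition epimorphism (X Y : topologicalType) (r : X -> Y) : Prop :=
  continuous r /\
  forall (Z : topologicalType) (g h : Y -> Z),
    continuous g -> continuous h -> g \o r = h \o r -> g = h.

Definition reflection (A : space_class) (X RX : topologicalType)
    (r : X -> RX) : Prop :=
  [/\ A RX, continuous r &
      forall (Y : topologicalType) (f : X -> Y), A Y -> continuous f ->
        exists! g : RX -> Y, continuous g /\ g \o r = f].

Definition epireflective (A : space_class) : Prop :=
  subcategory A /\
  forall X : topologicalType, exists (RX : topologicalType) (r : X -> RX),
    reflection A r /\ epimorphism r.

Definition quotient_map (X Y : topologicalType) (q : X -> Y) : Prop :=
  [/\ continuous q, set_surj [set: X] [set: Y] q &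
      forall V : set Y, open (q @^-1` V) -> open V].

(* Requiring the index type to be a choiceType is no restriction: classically
   every type carries such a structure. *)
Definition closed_under_sums (B : space_class) : Prop :=
  forall (I : choiceType) (X : I -> topologicalType),
    (forall i, B (X i)) -> B ({i : I & X i} : topologicalType).

Definition divisible_in (A B : space_class) : Prop :=
  forall (X Y : topologicalType) (q : X -> Y),
    quotient_map q -> B X -> A Y -> B Y.

Definition hereditary (B : space_class) : Prop :=
  forall (X : topologicalType) (S : set X),
    B X -> B (set_type S : topologicalType).

Record AD_class (A B : space_class) : Prop := ADClass {
  AD_subcategory : subcategory B;
  AD_sub : forall X : topologicalType, B X -> A X;
  AD_additive : closed_under_sums B;
  AD_divisible : divisible_in A B
}.

Definition HAD_class (A B : space_class) : Prop :=
  AD_class A B /\ hereditary B.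

Definition prime_factor (X : topologicalType) (a : X) : Type := X.

Section PrimeFactor.
Variables (X : topologicalType) (a : X).

HB.instance Definition _ := Choice.on (prime_factor a).

Definition prime_factor_nbhs (b : prime_factor a) :
    set_system (prime_factor a) :=
  if b == a then nbhs a else principal_filter (b : X).

HB.instance Definition _ := hasNbhs.Build (prime_factor a) prime_factor_nbhs.

Let prime_factor_nbhs_proper (b : prime_factor a) : ProperFilter (nbhs b).
Proof.
rewrite /nbhs /= /prime_factor_nbhs; case: ifP => _.
  exact: nbhs_pfilter.
exact: principal_filter_proper.
Qed.

Let prime_factor_nbhs_singleton (b : prime_factor a)
  (U : set (prime_factor a)) : nbhs b U -> U b.
Proof.
rewrite {1}/nbhs /= /prime_factor_nbhs; case: eqP => [-> | _].
  exact: nbhs_singleton.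
by move/principal_filterP.
Qed.

Let prime_factor_nbhs_nbhs (b : prime_factor a)
  (U : set (prime_factor a)) : nbhs b U -> nbhs b (nbhs^~ U).
Proof.
rewrite /nbhs /= /prime_factor_nbhs; case: eqP => [_ aU | /eqP ba].
  apply: filterS (aU) => c Uc; case: eqP => _ //.
  exact/principal_filterP.
move=> bU; apply/principal_filterP => /=.
by rewrite (negbTE ba).
Qed.

HB.instance Definition _ := Nbhs_isNbhsTopological.Build (prime_factor a)
  prime_factor_nbhs_proper prime_factor_nbhs_singleton prime_factor_nbhs_nbhs.

End PrimeFactor.

Definition closed_under_prime_factors (B : space_class) : Prop :=
  forall (X : topologicalType) (a : X),
    B X -> B (prime_factor a : topologicalType).

(* Main.v *)
(* If a is isolated in X, the prime factor is discrete. Otherwise B contains a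
   nondiscrete space P with a single non-isolated point p, obtained from a
   subspace of X by collapsing disjoint open sets. Glue a copy of P at p to
   every point of X. Since all new points are isolated, the result Y carries
   the initial topology for its retraction onto X and its clopen subsets, so Y
   belongs to A, hence to B. (Gluing copies of X itself would not do: for
   general A that space need not lie in A.) In the subspace of Y formed by a and
   all new points, the neighborhoods of a only see which copies of P lie over a
   neighborhood of a in X, so the projection onto the prime factor at a is a
   quotient map. *)
Require Import Defs.
From HB Require Import structures.
From mathcomp Require Import all_boot all_order all_algebra.
From mathcomp Require Import all_classical all_reals all_analysis.

Set Implicit Arguments.
Unset Strict Implicit.
Unset Printing Implicit Defensive.

Local Open Scope classical_set_scope.

(** * Subspaces, and membership in an epireflective class of Hausdorff spaces *)

Lemma nbhs_set_type (X : topologicalType) (S : set X) (x : set_type S)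
    (U : set (set_type S)) :
  nbhs x U <-> exists2 O, nbhs (set_val x) O & set_val @^-1` O `<=` U.
Proof.
split=> [[_ [[ O oO <-] Ox OU]]|[ O Ox OU]].
  by exists O => //; exact: open_nbhs_nbhs.
by apply: filterS OU _; exact: (@initial_continuous _ _ set_val).
Qed.

(** Every map into a two-point indiscrete space is continuous, and the indicator of the range of [r]
    agrees with the constant [true] after composition with [r]. *)
Lemma epimorphism_surj (X Y : topologicalType) (r : X -> Y) (y : Y) :
  epimorphism r -> exists x, r x = y.
Proof.
move=> [_ epi_r].
pose Z : topologicalType := @initial_topology bool bool (fun=> true).
have indiscrete (g : Y -> Z) : continuous g.
  move=> z U [_ [[ O _ <-] /= Oz OU]].
  by apply: filterS filterT => w _; exact: OU.
have /(congr1 (@^~ y)) /asboolP[x _ <-] :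
    (fun y => `[< range r y >]) = (fun=> true) :> (Y -> Z).
  apply: epi_r => //; apply/funext => x /=.
  by apply/asboolP; exists x.
by exists x.
Qed.

(** The last hypothesis gives [Y] the initial topology for its maps into [A] and its clopen sets.
    All of these factor through the reflection [r], so [r] induces the topology of [Y]; closed
    points make it injective and the epimorphism property makes it onto, hence a homeomorphism. *)
Lemma epireflective_initial (A : space_class) (Y : topologicalType) :
    epireflective A ->
    (forall X : topologicalType, A X -> hausdorff_space X) ->
    (forall y : Y, closed [set y]) ->
    (forall (y : Y) (U : set Y), nbhs y U ->
      exists2 C, clopen C /\ C y &
      exists (Z : topologicalType) (f : Y -> Z) (O : set Z),
        [/\ A Z, continuous f, nbhs (f y) O & f @^-1` O `&` C `<=` U]) ->
  A Y.
Proof.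
move=> [[isoA [X0 AX0 [x0 [x1 x01]]]] reflA] hausA closed1 initY.
have [RY [r [[ARY cr univ_r] epi_r]]] := reflA Y.
have nbhs_r (y : Y) (U : set Y) :
    nbhs y U -> exists2 O, nbhs (r y) O & r @^-1` O `<=` U.
  move=> /initY[C [[oC cC] Cy] [Z [f [ O [AZ cf Oy OCU]]]]].
  (* The two points of [X0] turn the clopen set [C] into a continuous map to a space of [A]. *)
  pose chi z : X0 := if `[< C z >] then x0 else x1.
  have chi_cont : continuous chi.
    apply/continuousP => V _; rewrite openE => z Vz.
    have [Cz|nCz] := pselect (C z).
      apply: filterS (open_nbhs_nbhs (conj oC Cz)) => w Cw.
      by move: Vz; rewrite /= /chi !asboolT.
    have : (~` C) z by [].
    move=> /(conj (closed_openC cC))/open_nbhs_nbhs; apply: filterS => w Cw.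
    by move: Vz; rewrite /= /chi !asboolF.
  have [g [[cg gr] _]] := univ_r _ _ AZ cf.
  have [h [[ch hr] _]] := univ_r _ _ AX0 chi_cont.
  have hry z : h (r z) = chi z by rewrite -hr.
  exists (g @^-1` O `&` h @^-1` (~` [set x1])).
    apply: filterI; first by apply: cg; rewrite -gr in Oy.
    apply: ch; apply: open_nbhs_nbhs; split.
      apply: closed_openC; apply: accessible_closed_set1.
      exact: hausdorff_accessible (hausA _ AX0).
    by rewrite /= hry /chi asboolT.
  move=> z [/= gO hx1]; apply: OCU; split; first by rewrite -gr.
  by apply: contrapT => nCz; apply: hx1; rewrite hry /chi asboolF.
have inj_r : injective r.
  move=> y y' ryy'; apply: contrapT => yy'.
  have : (~` [set y']) y by [].
  move=> /(conj (closed_openC (closed1 y')))/open_nbhs_nbhs/nbhs_r[ O ryO].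
  by move/(_ y'); apply => //=; rewrite -ryy'; exact: nbhs_singleton.
have [s rs] := choice (fun z => epimorphism_surj z epi_r).
apply: isoA ARY; exists s, r; split => //.
  move=> z U szU; have [ O + OU] := nbhs_r _ _ szU.
  rewrite rs; apply: filterS => w Ow; apply: OU.
  by rewrite /= rs.
by move=> y; apply: inj_r; rewrite rs.
Qed.

Lemma open_isolated (Y : topologicalType) (p : Y) (U : set Y) :
  (forall y, y <> p -> open [set y]) -> (U p -> nbhs p U) -> open U.
Proof.
move=> iso Up; rewrite openE => y Uy.
have [yp|yp] := pselect (y = p); first by move: Uy; rewrite yp; exact: Up.
by apply: filterS (open_nbhs_nbhs (conj (iso _ yp) erefl)) => _ ->.
Qed.

(** Every neighborhood of [p] is clopen because all other points are isolated, so clopen sets alone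
    generate the topology and a constant map into [A] suffices. *)
Lemma epireflective_prime (A : space_class) (Y : topologicalType) (p : Y) :
    epireflective A ->
    (forall X : topologicalType, A X -> hausdorff_space X) ->
    (forall y, y <> p -> open [set y]) -> (forall y : Y, closed [set y]) ->
  A Y.
Proof.
move=> epiA hausA iso closed1; apply: epireflective_initial => // y U yU.
exists (if `[< y = p >] then U else [set y]).
  case: asboolP => [yp|yp]; last by do 2?split => //; exact: iso.
  split; last exact: nbhs_singleton.
  split; first by apply: (open_isolated iso) => _; rewrite -yp.
  rewrite -openC; apply: (open_isolated iso).
  by rewrite /setC /= -yp => /(_ (nbhs_singleton yU)).
have [[_ [Z AZ [z _]]] _] := epiA.
exists Z, (fun=> z), setT; split => //.
- exact: cst_continuous.
- exact: filterT.
- move=> w [_]; case: asboolP => [//|_ ->]; exact: nbhs_singleton.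
Qed.

(** A jointly surjective family with the final topology amounts to a quotient map out of the
    topological sum. *)
Lemma AD_final (A B : space_class) (I : choiceType) (X : I -> topologicalType)
    (Y : topologicalType) (f : forall i, X i -> Y) :
    AD_class A B -> (forall i, B (X i)) -> A Y ->
    (forall i, continuous (f i)) -> (forall y, exists i x, f i x = y) ->
    (forall V, (forall i, open (f i @^-1` V)) -> open V) ->
  B Y.
Proof.
move=> AB BX AY cf surj_f final_f.
pose q (z : {i & X i}) := f (projT1 z) (projT2 z).
apply: (AD_divisible AB (q := q)) (AD_additive AB BX) AY; split.
- by move=> [i x] V /cf qV; exact: existT_continuous.
- by move=> y _; have [i [x <-]] := surj_f y; exists (existT _ i x).
- by move=> V /sigT_openP oV; apply: final_f => i; exact: oV.
Qed.

(** * Spaces with one non-isolated point, obtained by collapsing *)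

(* Pushes the neighborhood filter of [t] forward along [h]; the points of [J]
   other than [h t] are isolated. *)
Definition prime_image (T : topologicalType) (t : T) (J : choiceType)
  (h : T -> J) : Type := J.

Section PrimeImage.
Context (T : topologicalType) (t : T) (J : choiceType) (h : T -> J).
Local Notation P := (prime_image t h).

HB.instance Definition _ := Choice.on P.

Definition prime_image_nbhs (b : P) : set_system P :=
  if b == h t then h @ nbhs t else principal_filter (b : J).

HB.instance Definition _ := hasNbhs.Build P prime_image_nbhs.

Let prime_image_nbhs_proper (b : P) : ProperFilter (nbhs b).
Proof.
rewrite /nbhs /= /prime_image_nbhs; case: ifP => _.
  exact: fmap_proper_filter.
exact: principal_filter_proper.
Qed.

Let prime_image_nbhs_singleton (b : P) (U : set P) : nbhs b U -> U b.
Proof.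
rewrite {1}/nbhs /= /prime_image_nbhs; case: eqP => [-> | _].
  exact: (@nbhs_singleton _ t (h @^-1` U)).
by move/principal_filterP.
Qed.

Let prime_image_nbhs_nbhs (b : P) (U : set P) :
  nbhs b U -> nbhs b (nbhs^~ U).
Proof.
rewrite /nbhs /= /prime_image_nbhs; case: eqP => [_ aU | /eqP ba].
  apply: filterS (aU) => c Uc; rewrite /=; case: eqP => _ //.
  exact/principal_filterP.
move=> bU; apply/principal_filterP => /=.
by rewrite (negbTE ba).
Qed.

HB.instance Definition _ := Nbhs_isNbhsTopological.Build P
  prime_image_nbhs_proper prime_image_nbhs_singleton prime_image_nbhs_nbhs.

Lemma nbhs_prime_image (U : set P) : nbhs (h t : P) U = nbhs t (h @^-1` U).
Proof. by rewrite {1}/nbhs /= /prime_image_nbhs eqxx. Qed.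

Lemma prime_image_isolated (b : P) : b <> h t -> open [set b].
Proof.
move=> /eqP bt; rewrite openE => _ ->.
rewrite /interior /nbhs /= /prime_image_nbhs (negbTE bt).
exact/principal_filterP.
Qed.

Lemma prime_image_closed1 (b : P) :
  (forall j : J, j <> h t -> \forall x \near t, h x <> j) -> closed [set b].
Proof.
move=> Hj; rewrite -openC; apply: (open_isolated prime_image_isolated).
by rewrite nbhs_prime_image => bt; apply: Hj => tb; exact: bt.
Qed.

End PrimeImage.

Lemma HAD_prime_image (A B : space_class) (T : topologicalType) (t : T)
    (J : choiceType) (h : T -> J) :
    epireflective A ->
    (forall X : topologicalType, A X -> hausdorff_space X) ->
    HAD_class A B -> B T ->
    (forall x, x <> t -> h x <> h t /\ \forall y \near x, h y = h x) ->
    (forall j, j <> h t -> \forall x \near t, h x <> j) ->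
  B (prime_image t h : topologicalType).
Proof.
move=> epiA hausA [AB hB] BT Hh Hj.
(* One singleton for each [j] reaches the points outside the image of [h]. *)
pose F (o : option J) : topologicalType :=
  if o is Some _ then set_type [set t] else T.
pose f (o : option J) : F o -> prime_image t h :=
  if o is Some j then fun=> j else h.
apply: (@AD_final A B _ F _ f AB).
- by case=> [j|] //; exact: hB.
- apply: (@epireflective_prime A (prime_image t h : topologicalType) (h t)) => //.
    exact: prime_image_isolated.
  by move=> y; exact: prime_image_closed1.
- case=> [j|]; first exact: cst_continuous.
  move=> x U /=; have [->|xt] := pselect (x = t).
    by rewrite nbhs_prime_image.
  move=> /nbhs_singleton Ux; have [_] := Hh _ xt.
  by apply: filterS => y /= ->.
- by move=> j; exists (Some j), (exist _ t (mem_set erefl)).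
- move=> V /(_ None)/= oV; apply: (open_isolated (@prime_image_isolated _ t _ h)).
  by rewrite nbhs_prime_image => Vt; exact: open_nbhs_nbhs.
Qed.

(** * Gluing copies of a space to all points of another *)

(* [X] with a copy of [P] glued by its point [p] to every point of [X]: the
   point [c] of [X] is encoded as [(c, p)]. *)
Definition attach (X P : topologicalType) (p : P) : Type := (X * P)%type.

Section Attach.
Context (X P : topologicalType) (p : P).
Local Notation Y := (attach X p).

HB.instance Definition _ := Choice.on Y.

(** Unlike in the product topology, the neighborhood of [p] may vary with the base point. This is
    the quotient topology of the gluing when all points of [P] other than [p] are isolated. *)
Definition attach_nbhs (z : Y) : set_system Y :=
  if z.2 == p
  then [set U | \forall c \near z.1, \forall v \near p, U (c, v)]
  else principal_filter (z : X * P).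

HB.instance Definition _ := hasNbhs.Build Y attach_nbhs.

Let attach_nbhs_proper (z : Y) : ProperFilter (nbhs z).
Proof.
rewrite /nbhs /= /attach_nbhs; case: ifP => _; last first.
  exact: principal_filter_proper.
split=> [|]; first by move=> /nbhs_singleton/nbhs_singleton.
split=> [|U V|U V UV] /=.
- by apply: filterE => c; exact: filterT.
- by apply: filterS2 => c; exact: filterI.
- by apply: filterS => c; apply: filterS => v; exact: UV.
Qed.

Let attach_nbhs_singleton (z : Y) (U : set Y) : nbhs z U -> U z.
Proof.
case: z => b v; rewrite {1}/nbhs /= /attach_nbhs /=; case: eqP => [->|_].
  by move=> /nbhs_singleton/nbhs_singleton.
by move/principal_filterP.
Qed.

Let attach_nbhs_nbhs (z : Y) (U : set Y) : nbhs z U -> nbhs z (nbhs^~ U).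
Proof.
case: z => b v; rewrite /nbhs /= /attach_nbhs /=; case: eqP => [_|/eqP vp].
  move=> /= /nbhs_interior; apply: filterS => c cU.
  have := nbhs_singleton cU; apply: filterS => w Uw.
  by case: eqP => // _; exact/principal_filterP.
by move=> bU; apply/principal_filterP => /=; rewrite (negbTE vp).
Qed.

HB.instance Definition _ := Nbhs_isNbhsTopological.Build Y
  attach_nbhs_proper attach_nbhs_singleton attach_nbhs_nbhs.

Lemma nbhs_attach (b : X) (U : set Y) :
  nbhs ((b, p) : Y) U = \forall c \near b, \forall v \near p, U (c, v).
Proof. by rewrite {1}/nbhs /= /attach_nbhs eqxx. Qed.

Lemma open_attach (U : set Y) :
  (forall b, U (b, p) -> nbhs ((b, p) : Y) U) -> open U.
Proof.
move=> Up; rewrite openE => -[b v] Uz.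
have [vp|/eqP vp] := pselect (v = p); first by move: Uz; rewrite vp; exact: Up.
rewrite /interior /nbhs /= /attach_nbhs /= (negbTE vp).
exact/principal_filterP.
Qed.

Lemma attach_fst_continuous : continuous (fst : Y -> X).
Proof.
move=> [b v] U /= bU.
have oU : open (fst @^-1` U^° : set Y).
  apply: open_attach => c Uc; rewrite nbhs_attach.
  by apply: filterS (nbhs_interior Uc) => d Ud; exact: filterE.
have := open_nbhs_nbhs (conj oU (bU : (fst @^-1` U^° : set Y) (b, v))).
by apply: filterS => -[c w] /= /nbhs_singleton.
Qed.

Lemma attach_closed1 (y : Y) :
  (forall x : X, closed [set x]) -> (forall v : P, closed [set v]) ->
  closed [set y].
Proof.
move=> closedX closedP; rewrite -openC; apply: open_attach => b.
case: y => c w /= bcw; rewrite nbhs_attach.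
have [wp|wp] := pselect (w = p).
  have : (~` [set c]) b by move=> bc; apply: bcw; rewrite bc wp.
  move=> /(conj (closed_openC (closedX c)))/open_nbhs_nbhs.
  by apply: filterS => d dc; apply: filterE => v [].
apply: filterE => d.
have : (~` [set w]) p by move=> pw; exact: wp.
move=> /(conj (closed_openC (closedP w)))/open_nbhs_nbhs.
by apply: filterS => v vw [].
Qed.

Lemma epireflective_attach (A : space_class) :
    epireflective A ->
    (forall X : topologicalType, A X -> hausdorff_space X) ->
    A X -> (forall v : P, closed [set v]) ->
  A (Y : topologicalType).
Proof.
move=> epiA hausA AX closedP.
have closedX (x : X) : closed [set x].
  apply: accessible_closed_set1.
  exact: hausdorff_accessible (hausA _ AX).
have closedY (y : Y) : closed [set y] by exact: attach_closed1.
apply: epireflective_initial => // -[b v] U zU.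
have [vp|vp] := pselect (v = p); last first.
  exists [set (b, v)].
    by do 2?split => //; apply: open_attach => c [_ /esym].
  exists X, fst, setT; split => //; first exact: attach_fst_continuous.
    exact: filterT.
  by move=> z [_ ->]; exact: (nbhs_singleton zU).
move: zU; rewrite {}vp nbhs_attach => zU.
pose O := [set c | \forall v \near p, U (c, v)].
(* The points of [Y] outside [C] are all isolated. *)
pose C : set Y := [set z | O z.1 -> U z].
have Cp c : C (c, p) by exact: nbhs_singleton.
exists C.
  (* Over a point of [O] the fibre of [C] is that of [U], a neighborhood of [p]; over any other
     point it is all of [P]. *)
  split=> //; split.
    apply: open_attach => c _; rewrite nbhs_attach.
    apply: filterE => d.
    have [Od|nOd] := pselect (O d); first by apply: filterS Od => w Uw _.
    by apply: filterE => w /nOd.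
  by rewrite -openC; apply: open_attach => c /(_ (Cp c)).
exists X, fst, O; split => //; first exact: attach_fst_continuous.
by move=> z [/= Oz /(_ Oz)].
Qed.

(** The topology is final for the inclusions of [X] and of the copies of [P], one for each point of
    [X]. *)
Lemma AD_attach (A B : space_class) :
    AD_class A B -> B X -> B P -> A (Y : topologicalType) ->
    (forall v : P, v <> p -> open [set v]) ->
  B (Y : topologicalType).
Proof.
move=> AB BX BP AY isoP.
pose F (o : option X) : topologicalType := if o is Some _ then P else X.
pose f (o : option X) : F o -> Y :=
  if o is Some b then fun v => (b, v) else fun x => (x, p).
apply: (@AD_final A B _ F _ f AB) => //.
- by case.
- case=> [b|] /=.
    apply/continuousP => V oV; apply: (open_isolated isoP) => /= Vbp.
    have := open_nbhs_nbhs (conj oV (Vbp : V (b, p))); rewrite nbhs_attach.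
    exact: nbhs_singleton.
  move=> x V /=; rewrite nbhs_attach; apply: filterS => c.
  exact: nbhs_singleton.
- by move=> [b v]; exists (Some b), v.
- move=> V oV; apply: open_attach => b Vb; rewrite nbhs_attach.
  have := open_nbhs_nbhs (conj (oV None) (Vb : (f None @^-1` V) b)).
  apply: filterS => c Vc.
  exact: open_nbhs_nbhs (conj (oV (Some c)) (Vc : (f (Some c) @^-1` V) p)).
Qed.

End Attach.

(** * Prime factors, and a nondiscrete prime space in the class *)

Lemma nbhs_prime_factor (X : topologicalType) (a : X) (U : set X) :
  nbhs (a : prime_factor a) U = nbhs a U.
Proof. by rewrite {1}/nbhs /= /prime_factor_nbhs eqxx. Qed.

Lemma prime_factor_isolated (X : topologicalType) (a : X)
    (b : prime_factor a) :
  b <> a -> open [set b].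
Proof.
move=> /eqP ba; rewrite openE => _ ->.
rewrite /interior /nbhs /= /prime_factor_nbhs (negbTE ba).
exact/principal_filterP.
Qed.

Lemma epireflective_prime_factor (A : space_class) (X : topologicalType)
    (a : X) :
    epireflective A ->
    (forall X : topologicalType, A X -> hausdorff_space X) ->
    A X ->
  A (prime_factor a : topologicalType).
Proof.
move=> epiA hausA AX.
apply: (@epireflective_prime A (prime_factor a : topologicalType) a) => //.
  exact: prime_factor_isolated.
move=> b; rewrite -openC; apply: (open_isolated (@prime_factor_isolated _ a)).
rewrite nbhs_prime_factor => ab; apply: open_nbhs_nbhs; split=> //.
apply: closed_openC; apply: accessible_closed_set1.
exact: hausdorff_accessible (hausA _ AX).
Qed.

(** The prime factor is discrete, hence a quotient of a sum of copies of the subspace formed by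
    [a]. *)
Lemma HAD_prime_factor_isolated (A B : space_class) (X : topologicalType)
    (a : X) :
    epireflective A ->
    (forall X : topologicalType, A X -> hausdorff_space X) ->
    HAD_class A B -> B X -> nbhs a [set a] ->
  B (prime_factor a : topologicalType).
Proof.
move=> epiA hausA [AB hB] BX isoa.
apply: (@AD_final A B X (fun=> set_type [set a] : topologicalType)
  (prime_factor a) (fun b _ => b) AB).
- by move=> _; exact: hB.
- by apply: epireflective_prime_factor => //; exact: (AD_sub AB).
- by move=> b; exact: cst_continuous.
- by move=> b; exists b, (exist _ a (mem_set erefl)).
- move=> V _; apply: (open_isolated (@prime_factor_isolated _ a)) => Va.
  by rewrite nbhs_prime_factor; apply: filterS isoa => _ ->.
Qed.

(* A maximal disjoint family of nonempty open sets whose closures avoid [a] has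
   [a] in the closure of its union; collapsing each member to a point gives the
   required space. *)
Lemma HAD_nondiscrete_prime (A B : space_class) (X : topologicalType) (a : X) :
    epireflective A ->
    (forall X : topologicalType, A X -> hausdorff_space X) ->
    HAD_class A B -> B X -> ~ nbhs a [set a] ->
  exists (P : topologicalType) (p : P),
    [/\ B P, forall v, v <> p -> open [set v], forall v : P, closed [set v]
      & ~ nbhs p [set p]].
Proof.
move=> epiA hausA HAB BX nisoa; have [AB hB] := HAB.
have hausX : hausdorff_space X by apply: hausA; exact: (AD_sub AB).
pose G := [set W : set X | [/\ open W, W !=set0 & ~ closure W a]].
have [D [DG tD maxD]] := ex_maximal_disjoint_subcollection id G.
have Da W : D W -> ~ W a.
  by move=> /DG[_ _ aW] /subset_closure.
(* If [O] missed every member of [D], separating [a] from another point of the interior of [O] would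
   yield an open set that could be added to [D]. *)
have dense_D (O : set X) : nbhs a O -> exists2 W, D W & O `&` W !=set0.
  move=> aO; apply: contrapT => OD.
  have [x [Ox xa]] : exists x, O^° x /\ x <> a.
    apply: contrapT => nx; apply: nisoa.
    apply: filterS (nbhs_interior aO) => x Ox; apply: contrapT => xa.
    by apply: nx; exists x.
  move: hausX; rewrite open_hausdorff => /(_ x a).
  have /eqP-/[swap]/[apply] := xa.
  move=> [[U V] /= [/set_mem Ux /set_mem Va] [oU oV /eqP UV0]].
  pose W := U `&` O^°.
  have Wx : W x by [].
  have GW : G W.
    split; first by apply: openI => //; exact: open_interior.
      by exists x.
    move=> /(_ V (open_nbhs_nbhs (conj oV Va)))[y [[Uy _] Vy]].
    by rewrite -[False]/(set0 y) -UV0.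
  have disjW E : D E -> W `&` E = set0.
    move=> DE; apply/seteqP; split=> // y [[_ /interior_subset Oy] Ey].
    by apply: OD; exists E => //; exists y.
  have nDW : ~ D W.
    by move=> /disjW; rewrite setIid => W0; move: Wx; rewrite W0.
  apply: (maxD (W |` D)).
  - by split; [move=> E; right|move=> /(_ W (or_introl erefl))].
  - by move=> E [->|/DG].
  - move=> E F [->|DE] [->|DF] //.
    + by move=> [y]; rewrite disjW.
    + by move=> [y]; rewrite setIC disjW.
    + exact: tD.
pose S := [set x | x = a \/ exists2 W, D W & W x].
(* By disjointness this union is the unique member of [D] containing [x], or the empty set when [x]
   is [a]. *)
pose h (x : set_type S) := \bigcup_(W in [set W | D W /\ W (val x)]) W.
have hE (x : set_type S) W : D W -> W (val x) -> h x = W.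
  move=> DW Wx; apply/seteqP; split=> [y [E [DE Ex] Ey]|y Wy].
    by rewrite (tD W E DW DE) //; exists (val x).
  by exists W.
pose t : set_type S := exist _ a (mem_set (or_introl erefl)).
have ht : h t = set0.
  by apply/seteqP; split=> // y [W [/Da]].
have Sx (x : set_type S) : x <> t -> exists2 W, D W & W (val x).
  move=> xt; case: (set_mem (valP x)) => // xa.
  by exfalso; apply: xt; exact: val_inj.
have h_isolated x : x <> t -> h x <> h t /\ \forall y \near x, h y = h x.
  move=> /Sx[W DW Wx]; have [oW _ _] := DG _ DW.
  rewrite (hE _ _ DW Wx) ht; split; first by move=> W0; rewrite W0 in Wx.
  apply/nbhs_set_type; exists W; first exact: open_nbhs_nbhs.
  by move=> y Wy; exact: hE.
(* For [W] in [D], the complement of its closure is a neighborhood of [a]; any other nonempty [W] is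
   not a value of [h]. *)
have h_near W : W <> h t -> \forall x \near t, h x <> W.
  rewrite ht => W0; have [DW|nDW] := pselect (D W); last first.
    apply: filterE => x; have [->|/Sx[E DE Ex]] := pselect (x = t).
      by rewrite ht => /esym.
    by rewrite (hE _ _ DE Ex) => EW; apply: nDW; rewrite -EW.
  have [_ _ aW] := DG _ DW.
  apply/nbhs_set_type; exists (~` closure W).
    apply: open_nbhs_nbhs; split=> //.
    by apply: closed_openC; exact: closed_closure.
  move=> x /= nWx; have [->|/Sx[E DE Ex]] := pselect (x = t).
    by rewrite ht => /esym.
  rewrite (hE _ _ DE Ex) => EW; apply: nWx; apply: subset_closure.
  by rewrite -EW.
exists (prime_image t h), (h t); split.
- by apply: HAD_prime_image HAB _ _ _ => //; exact: hB.
- exact: prime_image_isolated.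
- by move=> v; exact: prime_image_closed1.
- rewrite nbhs_prime_image => /nbhs_set_type[ O aO OU].
  have [W DW [x [Ox Wx]]] := dense_D O aO.
  have Sx' : S x by right; exists W.
  pose x' : set_type S := exist _ x (mem_set Sx').
  have := OU x' Ox.
  by rewrite /= ht (hE x' W DW Wx) => W0; rewrite W0 in Wx.
Qed.

Theorem theorem3p14 (A B : space_class)
  (A_epireflective : epireflective A)
  (A_hausdorff : forall X : topologicalType, A X -> hausdorff_space X)
  (B_HAD : HAD_class A B) :
  closed_under_prime_factors B.
Proof.
move=> X a BX.
have [isoa|nisoa] := pselect (nbhs a [set a]).
  exact: HAD_prime_factor_isolated A_epireflective A_hausdorff B_HAD BX isoa.
have [AB hB] := B_HAD.
have [P [p [BP isoP closedP nisop]]] :=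
  HAD_nondiscrete_prime A_epireflective A_hausdorff B_HAD BX nisoa.
have AX := AD_sub AB BX.
pose S : set (attach X p) := [set z | z.2 = p -> z.1 = a].
have BS : B (set_type S : topologicalType).
  apply: hB; apply: (AD_attach AB) => //.
  exact: (epireflective_attach p A_epireflective A_hausdorff AX closedP).
pose q (z : set_type S) : prime_factor a := (val z).1.
apply: (AD_divisible AB (q := q)) BS _; last exact: epireflective_prime_factor.
split.
- move=> z U; have [zp|zp] := pselect ((val z).2 = p).
    have qz : q z = a by exact: (set_mem (valP z)) zp.
    rewrite qz nbhs_prime_factor => aU; apply/nbhs_set_type.
    exists (fst @^-1` U) => //; apply: attach_fst_continuous.
    by rewrite -[_.1]/(q z) qz.
  move=> /nbhs_singleton Uz; apply/nbhs_set_type; exists [set val z].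
    apply: open_nbhs_nbhs; split=> //; apply: open_attach => b bz.
    by exfalso; apply: zp; rewrite -bz.
  by move=> w /= wz; rewrite /q -[val w]/(set_val w) wz.
(* Since [p] is not isolated, [P] has another point, so every [b] has a new point above it. *)
- have [v vp] : exists v : P, v <> p.
    apply: contrapT => nv; apply: nisop; apply: filterE => v.
    by apply: contrapT => vp; apply: nv; exists v.
  move=> b _.
  have Sbv : S (b, v) by move=> /vp.
  by exists (exist _ (b, v) (mem_set Sbv)).
- move=> V oV; apply: (open_isolated (@prime_factor_isolated _ a)) => Va.
  rewrite nbhs_prime_factor.
  have Sap : S (a, p) by [].
  pose z0 : set_type S := exist _ (a, p) (mem_set Sap).
  have := open_nbhs_nbhs (conj oV (Va : (q @^-1` V) z0)).
  move=> /nbhs_set_type[ O]; rewrite -[set_val z0]/((a, p) : attach X p).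
  rewrite nbhs_attach => aO OV; apply: filterS aO => c cO.
  (* The fibre of [O] over [c] is a neighborhood of the non-isolated point [p], so it contains a new
     point. That point lies in [S] even when [(c, p)] does not, which forces [c] into [V]. *)
  have [v [Ov vp]] : exists v, O (c, v) /\ v <> p.
    apply: contrapT => nv; apply: nisop; apply: filterS cO => v Ov.
    by apply: contrapT => vp; apply: nv; exists v.
  have Scv : S (c, v) by move=> /vp.
  exact: (OV (exist _ (c, v) (mem_set Scv))).
Qed.
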